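(* Let $R$ be a ring and let $I, J$ be proper ideals of $R$ with $I \subseteq J$. Then the following statements hold: (1) If $J$ is a weakly semiprimary ideal of $R$, then $\frac{J}{I}$ is a weakly semiprimary ideal of $\frac{R}{I}$. (2) If $I$ is a weakly semiprimary ideal of $R$ and $\frac{J}{I}$ is a weakly semiprimary ideal of $\frac{R}{I}$, then $J$ is a weakly semiprimary ideal of $R$.
   Context: All rings are commutative with $1 \neq 0$. An ideal is proper if it is not the whole ring; $\sqrt{I}$ denotes the radical of $I$. A proper ideal $I$ of a ring $R$ is weakly semiprimary if whenever $a,b\in R$ and $0 \neq ab \in I$, then $a \in \sqrt{I}$ or $b \in \sqrt{I}$. *)

(* Defs.v *)
From mathcomp Require Import all_boot all_algebra.
From mathcomp Require Import boolp.

Set Implicit Arguments.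
Unset Strict Implicit.
Unset Printing Implicit Defensive.

Import GRing.Theory.

Local Open Scope ring_scope.
Local Open Scope quotient_scope.

(* Subsets are boolean predicates. Classically every subset is one: the
   membership tests that are not decidable by computation use [`[< _ >]]. *)

Definition radical (R : comNzRingType) (I : {pred R}) : {pred R} :=
  [pred x | `[< exists n : nat, (0 < n)%N /\ x ^+ n \in I >]].

(* [idealr_closed] includes properness, as [1 \notin I]. *)
Definition weakly_semiprimary (R : comNzRingType) (I : {pred R}) : Prop :=
  idealr_closed I /\
  forall a b : R, a * b != 0 -> a * b \in I ->
    a \in radical I \/ b \in radical I.

(* J / I, the image of J under the projection R -> R / I. *)
Definition ideal_quotient (R : comNzRingType) (J I : idealr R) :
    {pred {ideal_quot I}} :=
  [pred y | `[< exists x : R, x \in J /\ y = \pi_{ideal_quot I} x >]].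
Arguments ideal_quotient {R} J I _.

(* Main.v *)
Require Import Defs.
From mathcomp Require Import all_boot all_algebra.
From mathcomp Require Import boolp.

Set Implicit Arguments.
Unset Strict Implicit.
Unset Printing Implicit Defensive.

Import GRing.Theory.

Local Open Scope ring_scope.
Local Open Scope quotient_scope.

(** The projection [R -> R / I] is a surjective ring morphism with kernel [I],
    and since [I] lies in [J] the preimage of [J / I] is exactly [J]
    ([mem_ideal_quotient_pi]); hence the preimage of the radical of [J / I] is
    the radical of [J] ([mem_radical_pi]).  The conditions on [J / I] and on [J]
    therefore differ only in the nonvanishing hypothesis: the product of the
    classes of [a] and [b] is nonzero when [a * b] is outside [I], which is
    stronger than [a * b != 0].  This gives (1) at once.  For (2), the pairs
    with [a * b != 0] that the quotient does not see have [a * b] in [I], and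
    for these the hypothesis on [I] puts [a] or [b] in the radical of [I], hence
    in that of [J]. *)

Lemma radicalP (R : comNzRingType) (I : {pred R}) (x : R) :
  reflect (exists n : nat, (0 < n)%N /\ x ^+ n \in I) (x \in radical I).
Proof. by rewrite inE; exact: asboolP. Qed.

Lemma radicalS (R : comNzRingType) (I J : {pred R}) :
  {subset I <= J} -> {subset radical I <= radical J}.
Proof.
by move=> sIJ x /radicalP[n [n_gt0 Ixn]]; apply/radicalP; exists n; rewrite sIJ.
Qed.

Section IdealQuotient.

Variables (R : comNzRingType) (I J : idealr R).
Hypothesis sIJ : {subset I <= J}.

Local Notation piI := (\pi_{ideal_quot I}).

Lemma pi_eq0 (x : R) : (piI x == 0) = (x \in I).
Proof. by rewrite -[0](rmorph0 piI) -Quotient.idealrBE subr0. Qed.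

(** If the class of [x] is that of some [y] in [J], then [x] differs from [y] by
    an element of [I], which is again in [J]. *)
Lemma mem_ideal_quotient_pi (x : R) : (piI x \in ideal_quotient J I) = (x \in J).
Proof.
rewrite inE; apply/asboolP/idP => [[y [Jy /eqP]]|Jx]; last by exists x.
by rewrite -Quotient.idealrBE => /sIJ Jxy; rewrite -(subrK y x) rpredD.
Qed.

Lemma mem_radical_pi (x : R) :
  (piI x \in radical (ideal_quotient J I)) = (x \in radical J).
Proof.
by apply/radicalP/radicalP => -[n [n_gt0 Jxn]]; exists n;
  move: Jxn; rewrite -rmorphXn mem_ideal_quotient_pi.
Qed.

Lemma ideal_quotient_closed : idealr_closed (ideal_quotient J I).
Proof.
split=> [||y u v].
- by rewrite -[0](rmorph0 piI) mem_ideal_quotient_pi rpred0.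
- by rewrite -[1](rmorph1 piI) mem_ideal_quotient_pi idealr1.
elim/quotW: y => a; elim/quotW: u => x; elim/quotW: v => z.
rewrite -rmorphM -rmorphD !mem_ideal_quotient_pi => Jx Jz.
by rewrite rpredD ?idealMr.
Qed.

End IdealQuotient.

Theorem corollary3p3 (R : comNzRingType) (I J : idealr R)
    (sIJ : {subset I <= J}) :
  (weakly_semiprimary J -> weakly_semiprimary (ideal_quotient J I)) /\
  (weakly_semiprimary I -> weakly_semiprimary (ideal_quotient J I) ->
   weakly_semiprimary J).
Proof.
split=> [[_ wsJ]|[_ wsI] [_ wsJI]]; split.
- exact: ideal_quotient_closed.
- elim/quotW=> a; elim/quotW=> b.
  rewrite -rmorphM pi_eq0 mem_ideal_quotient_pi // !mem_radical_pi // => nIab.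
  by apply: wsJ; apply: contraNneq nIab => ->; rewrite rpred0.
- by split=> [||a u v Ju Jv]; rewrite ?rpred0 ?idealr1 // rpredD ?idealMr.
move=> a b nz_ab Jab; have [Iab|nIab] := boolP (a * b \in I).
  by have [/(radicalS sIJ)|/(radicalS sIJ)] := wsI a b nz_ab Iab; [left|right].
rewrite -!(mem_radical_pi sIJ).
by apply: wsJI; rewrite -rmorphM ?pi_eq0 ?mem_ideal_quotient_pi.
Qed.
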